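(* For every graph $G$, let $P$ be a path with $|V(G)|$ vertices and let $\Pi$ be the set of all bijections $\pi : V(G) \rightarrow V(P)$. Then $$\min_{\pi \in \Pi}\ \max_{u \in V(P)} |\{vw \in E(G) : u \in V(P_{vw})\}| = \mathrm{pw}(L(G)) + 1,$$ where, for a given $\pi$, $P_{vw}$ denotes the subpath of $P$ from $\pi(v)$ to $\pi(w)$.
   Context: Graphs are finite, simple and undirected, and $G$ has at least one vertex. The line graph $L(G)$ has vertex set $E(G)$, two distinct elements being adjacent if and only if the corresponding edges of $G$ share an endpoint. A path decomposition of a graph $H$ is a (nonempty) path $Q$ together with a collection of subsets of $V(H)$ (bags) indexed by the nodes of $Q$ such that: every vertex of $H$ is in at least one bag; for each vertex $v$ of $H$, the nodes whose bags contain $v$ induce a connected subpath of $Q$; and for each edge of $H$ some bag contains both its endpoints. Its width is the size of the largest bag minus 1, and the pathwidth $\mathrm{pw}(H)$ is the minimum width of a path decomposition of $H$ (so $\mathrm{pw}(H)=-1$ if $H$ has no vertices). *)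

(* Defs.v *)
From mathcomp Require Import all_boot all_algebra.
From mathcomp Require Import boolp.

Set Implicit Arguments.
Unset Strict Implicit.
Unset Printing Implicit Defensive.

Record sgraph := SGraph {
  vertex :> finType;
  adj : rel vertex;
  adj_sym : symmetric adj;
  adj_irrefl : irreflexive adj
}.

Definition edges (G : sgraph) : {set {set G}} :=
  [set [set v; w] | v in G, w in G & adj v w].

Section LineGraph.
Variable G : sgraph.

Definition line_vertex := {E : {set G} | E \in edges G}.

Definition line_adj : rel line_vertex :=
  [rel E F | (E != F) && (val E :&: val F != set0)].

Lemma line_adj_sym : symmetric line_adj.
Proof. by move=> E F; rewrite /line_adj [LHS]/= [RHS]/= setIC [E == F]eq_sym. Qed.

Lemma line_adj_irrefl : irreflexive line_adj.
Proof. by move=> E; apply/negP => /andP[/eqP]. Qed.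

Definition line_graph : sgraph := SGraph line_adj_sym line_adj_irrefl.
End LineGraph.

Section PathGraph.
Variable n : nat.

Definition path_adj : rel 'I_n :=
  [rel i j : 'I_n | (i.+1 == j) || (j.+1 == i)].

Lemma path_adj_sym : symmetric path_adj.
Proof. by move=> i j; exact: orbC. Qed.

Lemma path_adj_irrefl : irreflexive path_adj.
Proof. by move=> i; apply/negP => /orP[] /eqP /esym /n_Sn. Qed.

Definition path_graph : sgraph := SGraph path_adj_sym path_adj_irrefl.

(* The vertex set of the subpath between i and j, in either order. *)
Definition subpath (i j : path_graph) : {set path_graph} :=
  [set k : 'I_n | minn (i : 'I_n) (j : 'I_n) <= k <= maxn (i : 'I_n) (j : 'I_n)].
End PathGraph.

Definition induces_connected (G : sgraph) (S : {set G}) : Prop :=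
  {in S &, forall x y,
    connect [rel a b | [&& a \in S, b \in S & adj a b]] x y}.

Definition min_nat (P : nat -> Prop) (exP : exists k, P k) : nat :=
  @ex_minn (fun k => `[< P k >])
    (let: ex_intro k Pk := exP in ex_intro _ k (asboolT Pk)).

Section Pathwidth.
Variable H : sgraph.

Record path_decomposition (q : nat) (B : path_graph q.+1 -> {set H}) : Prop := {
  pd_vertex : forall v, exists t, v \in B t;
  pd_connected : forall v, induces_connected [set t | v \in B t];
  pd_edge : forall v w, adj v w -> exists t, (v \in B t) && (w \in B t)
}.

Definition width (q : nat) (B : path_graph q.+1 -> {set H}) : int :=
  ((\max_t #|B t|)%:Z - 1)%R.

(* Widths are at least -1, so they are shifted by one to minimise over nat. *)
Definition has_width_pred (k : nat) : Prop :=
  exists q (B : path_graph q.+1 -> {set H}),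
    path_decomposition B /\ width B = (k%:Z - 1)%R.

Lemma has_width_pred_ex : exists k, has_width_pred k.
Proof.
exists #|H|, 0, (fun=> [set: H]); split; last first.
  by rewrite /width big_ord1 cardsT.
split=> [v|v s t _ _|v w _].
- by exists (ord0 : 'I_1); rewrite inE.
- by rewrite (ord1 s) (ord1 t) connect0.
- by exists (ord0 : 'I_1); rewrite !inE.
Qed.

Definition pathwidth : int := ((min_nat has_width_pred_ex)%:Z - 1)%R.
End Pathwidth.

Section Layout.
Variable G : sgraph.

(* The edges vw of G whose subpath of P contains u. *)
Definition edges_over (pi : G -> path_graph #|G|) (u : path_graph #|G|) :
    {set {set G}} :=
  [set [set v; w] | v in G, w in G & adj v w && (u \in subpath (pi v) (pi w))].

Definition layout_cost (pi : G -> path_graph #|G|) : nat :=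
  \max_u #|edges_over pi u|.

Definition has_layout_cost (k : nat) : Prop :=
  exists2 pi : G -> path_graph #|G|, bijective pi & layout_cost pi = k.

Lemma has_layout_cost_ex : exists k, has_layout_cost k.
Proof.
exists (layout_cost (fun v => enum_rank v : path_graph #|G|)).
by exists (fun v => enum_rank v : path_graph #|G|); first exact: enum_rank_bij.
Qed.

Definition min_layout_cost : nat := min_nat has_layout_cost_ex.
End Layout.

(* Main.v *)
Require Import Defs.
From mathcomp Require Import all_boot all_algebra.
From mathcomp Require Import boolp.

Set Implicit Arguments.
Unset Strict Implicit.
Unset Printing Implicit Defensive.

(** A layout [pi] turns the sets of edges over each position into the bags of a
    path decomposition of the line graph, the edges at [v] all lying over [pi v].
    Conversely the edges at a vertex [v] form a clique of the line graph, so by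
    the Helly property some bag [t v] contains all of them.  Lay the vertices out
    by increasing [t], ties broken arbitrarily: an edge [vw] over the position
    of [x] has [t v <= t x <= t w] and belongs to the bags [t v] and [t w], hence
    to the bag [t x]. *)

Lemma min_natP (P : nat -> Prop) (exP : exists k, P k) : P (min_nat exP).
Proof. by rewrite /min_nat; case: ex_minnP => m /asboolP. Qed.

Lemma min_nat_le (P : nat -> Prop) (exP : exists k, P k) k :
  P k -> min_nat exP <= k.
Proof.
by move=> Pk; rewrite /min_nat; case: ex_minnP => m _; apply; apply/asboolP.
Qed.

(** A discrete intermediate value argument: a walk inside [S] changes position by one at each step,
    so it cannot get from below [z] to above [z] without visiting [z]. *)
Lemma path_connected_convex n (S : {set path_graph n}) (x y z : 'I_n) :
  induces_connected S -> x \in S -> y \in S -> x <= z <= y -> z \in S.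
Proof.
move=> conS xS yS /andP[xz zy]; apply: contraT => zS.
(* Assuming [z] is outside [S], weak and strict comparison with [z] agree on [S]; this keeps every
   vertex of the walk strictly below [z] in the induction. *)
have ltz (a : 'I_n) : a \in S -> (a <= z) = (a < z).
  by move=> aS; rewrite leq_eqVlt; case: eqP => // /val_inj az; rewrite -az aS in zS.
have /connectP[p] := conS x y xS yS.
rewrite ltz // in xz; move: zy; rewrite leqNgt; move: xz.
elim: p x {xS} => [|a p IHp] x xz zy /=; first by move=> _ yx; rewrite yx xz in zy.
case/andP=> /and3P[_ aS xa] ap ylast; apply: (IHp a) => //.
rewrite -ltz //; case/orP: xa => /eqP xa; first by rewrite -xa.
by rewrite ltnW // (leq_trans _ (ltnW xz)) // -xa.
Qed.

Lemma convex_path_connected n (S : {set path_graph n}) :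
  (forall x y z : 'I_n, x \in S -> y \in S -> x <= z <= y -> z \in S) ->
  induces_connected S.
Proof.
move=> convS.
have symS : connect_sym [rel a b | [&& a \in S, b \in S & adj a b]].
  apply: sym_connect_sym => a b /=.
  by rewrite andbCA; congr [&& _, _ & _]; exact: path_adj_sym.
(* Walk upwards from [x] one position at a time, by induction on the distance [d]; the case where
   [y] lies below [x] follows by symmetry. *)
have up d (x y : 'I_n) : x \in S -> y \in S -> y = x + d :> nat ->
    connect [rel a b : path_graph n | [&& a \in S, b \in S & adj a b]] x y.
  elim: d x => [|d IHd] x xS yS yxd.
    by have -> : x = y by apply: val_inj; rewrite /= yxd addn0.
  have ltx : x.+1 < n.
    by rewrite (leq_trans _ (ltn_ord y)) // yxd addnS !ltnS leq_addr.
  pose x' := Ordinal ltx.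
  have x'S : x' \in S.
    by apply: (convS x y) => //=; rewrite leqnSn yxd addnS ltnS leq_addr.
  apply: (@connect_trans _ _ x'); last by apply: IHd; rewrite //= yxd addSnnS.
  by apply: connect1; rewrite /= xS x'S /= /path_adj /= eqxx.
move=> x y xS yS; case: (leqP (x : 'I_n) (y : 'I_n)) => xy.
  by apply: (up (y - x)); rewrite // subnKC.
by rewrite symS; apply: (up (x - y)); rewrite // subnKC // ltnW.
Qed.

Section LayoutToDecomposition.
Variable G : sgraph.

(** Subpaths are intervals, so it suffices to have one endpoint at or before [u] and one at or after
    it. This form does not order the endpoints, which suits edges given as sets. *)
Lemma in_edges_over (pi : G -> path_graph #|G|) (u : 'I_#|G|) (E : {set G}) :
  (E \in edges_over pi u) =
  [&& E \in edges G, [exists a in E, (pi a : 'I__) <= u]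
    & [exists b in E, u <= (pi b : 'I__)]].
Proof.
apply/imset2P/and3P => [[v w _] | [/imset2P[v w _]]].
- rewrite !inE geq_min leq_max => /andP[vG /andP[vw /andP[uge ule]]] ->; split.
  + by apply/imset2P; exists v w; rewrite ?inE ?vw.
  + case/orP: uge => le; apply/exists_inP; [exists v | exists w] => //.
      by rewrite set21.
    by rewrite set22.
  + case/orP: ule => le; apply/exists_inP; [exists v | exists w] => //.
      by rewrite set21.
    by rewrite set22.
- rewrite inE => /andP[_ vw] -> /exists_inP[a aE age] /exists_inP[b bE bge].
  exists v w => //; rewrite !inE vw geq_min leq_max /=.
  apply/andP; split.
    by case/set2P: aE => <-; rewrite age ?orbT.
  by case/set2P: bE => <-; rewrite bge ?orbT.
Qed.

Lemma line_pathwidth_le_layout (pi : G -> path_graph #|G|) : 0 < #|G| ->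
  exists2 k, has_width_pred (line_graph G) k & k <= layout_cost pi.
Proof.
move=> G0; have eG := prednK G0.
(* Decompositions are indexed by a successor, so [#|G|] is rewritten as [#|G|.-1.+1] and positions
   are transported by [cast_ord]. *)
pose B (t : path_graph (#|G|.-1.+1)) : {set line_graph G} :=
  [set E | val E \in edges_over pi (cast_ord eG t)].
exists (\max_t #|B t|); last first.
  apply/bigmax_leqP => t _; apply: leq_trans (leq_bigmax (cast_ord eG t)).
  rewrite -(card_imset _ val_inj) subset_leq_card //.
  by apply/subsetP => _ /imsetP[E EB ->]; rewrite inE in EB.
have over_end (E : line_graph G) v : v \in val E ->
    E \in B (cast_ord (esym eG) (pi v)).
  move=> vE; rewrite inE in_edges_over (valP E) cast_ordKV /=.
  by apply/andP; split; apply/exists_inP; exists v.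
exists #|G|.-1, B; split=> //; split.
- move=> E; have /imset2P[v w _ _ EE] := valP E.
  by exists (cast_ord (esym eG) (pi v)); apply: over_end; rewrite EE set21.
- move=> E; apply: convex_path_connected => s t z.
  rewrite !inE !in_edges_over => /and3P[-> /exists_inP[a aE las] _].
  move=> /and3P[_ _ /exists_inP[b bE tb]] /andP[sz zt] /=.
  apply/andP; split; apply/exists_inP.
    by exists a => //; apply: leq_trans las _.
  by exists b => //; apply: leq_trans tb.
- move=> E F /andP[_ /set0Pn[v /setIP[vE vF]]].
  by exists (cast_ord (esym eG) (pi v)); rewrite !over_end.
Qed.

End LayoutToDecomposition.

Lemma exists_sorting_bijection (T : finType) (t : T -> nat) :
  exists2 pi : T -> 'I_#|T|, bijective pi
    & forall x y, pi x <= pi y -> t x <= t y.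
Proof.
(* Each element is sent to its index in the enumeration of [T] sorted by [t]. *)
pose r := relpre t leq; pose s := sort r (enum T).
have ms x : x \in s by rewrite mem_sort mem_enum.
have lt_index x : index x s < #|T| by rewrite cardT -(size_sort r) index_mem.
exists (fun x => Ordinal (lt_index x)).
  apply: inj_card_bij; last by rewrite card_ord.
  by move=> x y /(congr1 val) /= /index_inj ->.
move=> x y /=; apply: (@sorted_leq_index _ r) => //.
- by move=> a b c; exact: leq_trans.
- by move=> a; exact: leqnn.
- by apply: sort_sorted => a b; exact: leq_total.
Qed.

Section DecompositionToLayout.
Variables (G : sgraph) (q : nat).
Variable B : path_graph q.+1 -> {set line_graph G}.
Hypothesis decB : path_decomposition B.

Lemma bag_convex (E : line_graph G) (s z t : 'I_q.+1) :
  E \in B s -> E \in B t -> s <= z <= t -> E \in B z.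
Proof.
move=> Es Et szt.
have := @path_connected_convex _ [set t | E \in B t] s t z (pd_connected decB (v := E)).
by rewrite !inE; apply.
Qed.

(** Helly property for intervals: among the edges at [v], take the one, [E], whose interval of bags
    starts last. Any other edge [F] at [v] starts no later and shares a bag [s] with [E], where
    [first F <= first E <= s]; by convexity [F] is in the bag [first E]. *)
Lemma exists_star_bag (v : G) :
  exists t : 'I_q.+1, forall E : line_graph G, v \in val E -> E \in B t.
Proof.
have [first firstP] : exists first : line_graph G -> 'I_q.+1,
    forall E, E \in B (first E) /\ forall s : 'I_q.+1, E \in B s -> first E <= s.
  apply: (@fin_all_exists _ _ (fun E (l : 'I_q.+1) =>
    E \in B l /\ forall s : 'I_q.+1, E \in B s -> l <= s)) => E.
  have [t Et] := pd_vertex decB E.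
  have [l El lP] := @arg_minnP _ t [pred t | E \in B t] (fun t : 'I__ => t) Et.
  by exists l.
have [[E0 vE0]|noE] := pselect (exists E : line_graph G, v \in val E); last first.
  (* At an isolated vertex any bag works. *)
  by exists ord0 => E vE; case: noE; exists E.
have [E vE maxE] := @arg_maxnP _ E0 (fun E : line_graph G => v \in val E)
  first vE0.
exists (first E) => F vF; have [<-|EF] := eqVneq E F; first by case: (firstP E).
have /(pd_edge decB)[s /andP[Es Fs]] : adj E F.
  by apply/andP; split=> //; apply/set0Pn; exists v; rewrite inE vE.
apply: (@bag_convex F (first F) _ s) => //; first by case: (firstP F).
by apply/andP; split; [exact: maxE | case: (firstP E) => _; apply].
Qed.

Lemma layout_le_line_bags :
  exists2 k, has_layout_cost G k & k <= \max_t #|B t|.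
Proof.
have [t tP] := fin_all_exists exists_star_bag.
have [pi pi_bij pi_t] := @exists_sorting_bijection G (fun v => t v).
exists (layout_cost pi); first by exists pi.
have [rho piK rhoK] := pi_bij.
(* The edges over [u] are compared with the bag assigned to [rho u], the vertex placed at [u]. *)
apply/bigmax_leqP => u _; apply: leq_trans (leq_bigmax (t (rho u))).
rewrite -(card_imset (B (t (rho u))) val_inj) subset_leq_card //; apply/subsetP => E.
rewrite in_edges_over => /and3P[EG /exists_inP[a aE au] /exists_inP[b bE ub]].
apply/imsetP; exists (Sub E EG : line_graph G) => //.
apply: (@bag_convex _ (t a) _ (t b)); [exact: tP | exact: tP |].
by rewrite !pi_t // rhoK.
Qed.

End DecompositionToLayout.

Theorem theorem2p6 (G : sgraph) (hG : 0 < #|G|) :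
  ((min_layout_cost G)%:Z = pathwidth (line_graph G) + 1)%R.
Proof.
rewrite /pathwidth GRing.subrK; congr Posz; apply/eqP; rewrite eqn_leq.
apply/andP; split.
  have [q [B [decB widthB]]] := min_natP (has_width_pred_ex (line_graph G)).
  have [k Gk kB] := layout_le_line_bags decB.
  apply: leq_trans (min_nat_le (has_layout_cost_ex G) Gk) _.
  by move: widthB => /GRing.addIr [<-].
have [pi _ pi_cost] := min_natP (has_layout_cost_ex G).
have [k Hk kpi] := line_pathwidth_le_layout pi hG.
apply: leq_trans (min_nat_le (has_width_pred_ex (line_graph G)) Hk) _.
by rewrite /min_layout_cost -pi_cost.
Qed.
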